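(* Let $\Delta t>0$, let $f^0\ge0$, and let $(f^n,r^n)_{n\ge0}$ be produced by the scheme SAV-1st-L: $r^0=\sqrt{H^0}$ and, for all $n\ge0$, the following two steps are performed. Step 1 (prediction): $(\tilde f^{n+1},r^{n+1})$ solves $$\frac{\tilde f^{n+1}-f^n}{\Delta t}=\frac{r^{n+1}}{\sqrt{H^n}}\,Q(f^n),\qquad \frac{r^{n+1}-r^n}{\Delta t}=\frac{1}{2\sqrt{H^n}}\int_\Omega\log f^n\,\frac{\tilde f^{n+1}-f^n}{\Delta t}\,dv.$$ Step 2 (correction): $(f^{n+1},\lambda^{n+1})$ solves, for all $v\in\Omega$, $$\frac{f^{n+1}(v)-\tilde f^{n+1}(v)}{\Delta t}=\lambda^{n+1}(v),\qquad \lambda^{n+1}(v)\ge0,\quad f^{n+1}(v)\ge0,\quad \lambda^{n+1}(v)f^{n+1}(v)=0.$$ Here $H^n=H(f^n)=\int_\Omega f^n\log f^n\,dv+C>0$. Then for all $n\ge0$ (and every step size $\Delta t>0$): (1) $f^n\ge0$; (2) (modified entropy dissipation) with $\tilde H^n=(r^n)^2$, $$\tilde H^{n+1}-\tilde H^n=-(r^{n+1}-r^n)^2+\frac{\Delta t\,(r^{n+1})^2}{H^n}\int_\Omega Q(f^n)\log f^n\,dv\le0.$$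
   Context: The scheme is a time discretization of the spatially homogeneous kinetic equation $\partial_t f=Q(f)$, $f=f(t,v)$. The velocity variable $v$ is kept continuous and ranges over a bounded (truncated) domain $\Omega\subset\mathbb{R}^d$; $f^n,\tilde f^{n},\lambda^{n}$ are real-valued functions of $v\in\Omega$ and each $r^n$ is a real number. The collision operator $Q$ (mapping functions on $\Omega$ to functions on $\Omega$) is assumed to satisfy, for every nonnegative function $f$ to which it is applied: - conservation: $\int_\Omega Q(f)\,dv=0$, $\int_\Omega Q(f)\,v\,dv=0$, $\int_\Omega Q(f)\,|v|^2\,dv=0$; - H-theorem: $\int_\Omega Q(f)\log f\,dv\le0$. The real constant $C$ is chosen so that $H(f)=\int_\Omega f\log f\,dv+C$ is positive for the functions at which it is evaluated. Conventions: $\log0=-\infty$ and $0\cdot(-\infty)=0$; it is a standing assumption that all integrals appearing are well defined and finite. *)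

(* Defs.v *)
From HB Require Import structures.
From mathcomp Require Import all_boot all_order all_algebra.
From mathcomp Require Import all_classical all_reals all_analysis.

Set Implicit Arguments.
Unset Strict Implicit.
Unset Printing Implicit Defensive.

Import Order.TTheory GRing.Theory Num.Theory.
Import numFieldNormedType.Exports.

Local Open Scope classical_set_scope.
Local Open Scope ring_scope.

(* R^d is represented by d-tuples, which carry the product Borel
   sigma-algebra. *)
Notation velocity R d := (d.-tuple (measurableTypeR R)).

Lemma beheadE_tuple (T : Type) (n : nat) (x : T) (v : n.-tuple T) :
  [tuple of behead [tuple of x :: v]] = v.
Proof. exact: val_inj. Qed.

Section lebesgue_cons.
Context (R : realType) (d : nat).
Variable mu : {sigma_finite_measure set (velocity R d) -> \bar R}.

Definition tuple_cons (x : measurableTypeR R * velocity R d) :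
  velocity R d.+1 := [tuple of x.1 :: x.2].

Lemma measurable_tuple_cons : measurable_fun setT tuple_cons.
Proof. by apply: measurable_cons. Qed.

(* R^(d+1) is identified with R * R^d. *)
Definition lebesgue_cons : set (velocity R d.+1) -> \bar R :=
  pushforward (@lebesgue_measure R \x mu)%E tuple_cons.

Let lebesgue_cons0 : lebesgue_cons set0 = 0%E.
Proof. by rewrite /lebesgue_cons /pushforward preimage_set0 measure0. Qed.

Let lebesgue_cons_ge0 A : (0 <= lebesgue_cons A)%E.
Proof.
exact: (measure_ge0 (@lebesgue_measure R \x mu : {measure set _ -> \bar R})%E).
Qed.

Let lebesgue_cons_sigma_additive : semi_sigma_additive lebesgue_cons.
Proof.
have mc A : measurable A -> measurable (tuple_cons @^-1` A).
  by move=> mA; rewrite -[X in measurable X]setTI; exact: measurable_tuple_cons.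
move=> F mF tF mUF; rewrite /lebesgue_cons /pushforward preimage_bigcup.
apply: measure_semi_sigma_additive.
- by move=> n; exact: mc.
- apply/trivIsetP => /= i j _ _ ij; rewrite -preimage_setI.
  by move/trivIsetP : tF => /(_ _ _ _ _ ij) ->//; rewrite preimage_set0.
- by rewrite -preimage_bigcup; exact: mc.
Qed.

HB.instance Definition _ := isMeasure.Build _ _ _ lebesgue_cons
  lebesgue_cons0 lebesgue_cons_ge0 lebesgue_cons_sigma_additive.

Lemma lebesgue_consE (A : set (measurableTypeR R)) (B : set (velocity R d)) :
  measurable A -> measurable B ->
  lebesgue_cons [set v | A (thead v) /\ B [tuple of behead v]] =
  (lebesgue_measure A * mu B)%E.
Proof.
move=> mA mB; rewrite -(product_measure1E lebesgue_measure mu mA mB).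
rewrite /lebesgue_cons /pushforward; congr (_ _).
by apply/seteqP; split=> -[x v] /=; rewrite /tuple_cons theadE beheadE_tuple.
Qed.

Let measurable_cylinder (A : set (measurableTypeR R)) (B : set (velocity R d)) :
  measurable A -> measurable B ->
  measurable [set v : velocity R d.+1 | A (thead v) /\ B [tuple of behead v]].
Proof.
move=> mA mB; apply: measurableI.
- rewrite -[X in measurable X]setTI.
  exact: (@measurable_tnth _ (measurableTypeR R) d.+1 ord0).
- rewrite -[X in measurable X]setTI.
  exact: (@measurable_behead _ (measurableTypeR R) d).
Qed.

Let lebesgue_cons_sigma_finite : sigma_finite setT lebesgue_cons.
Proof.
have /sigma_finiteP[F [TF ndF mF]] :=
  sigma_finiteT (@lebesgue_measure R : {sigma_finite_measure set _ -> \bar R}).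
have /sigma_finiteP[G [TG ndG mG]] := sigma_finiteT mu.
exists (fun n => [set v | F n (thead v) /\ G n [tuple of behead v]]).
  apply/esym; rewrite -subTset => v _.
  have [i _ Fi] : (\bigcup_i F i) (thead v) by rewrite -TF.
  have [j _ Gj] : (\bigcup_i G i) [tuple of behead v] by rewrite -TG.
  exists (maxn i j) => //; split.
    by move/subsetPset : (ndF _ _ (leq_maxl i j)); exact.
  by move/subsetPset : (ndG _ _ (leq_maxr i j)); exact.
move=> n; have [mFn Foo] := mF n; have [mGn Goo] := mG n.
split; first exact: measurable_cylinder.
rewrite lebesgue_consE//.
by apply: lte_mul_pinfty => //; rewrite ge0_fin_numE.
Qed.

HB.instance Definition _ := @Measure_isSigmaFinite.Build _ _ _ lebesgue_cons
  lebesgue_cons_sigma_finite.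

End lebesgue_cons.

(* Lebesgue measure on R^d. *)
Fixpoint lebesgue (R : realType) (d : nat) :
    {sigma_finite_measure set (velocity R d) -> \bar R} :=
  match d with
  | 0 => dirac [tuple]
  | d'.+1 => lebesgue_cons (lebesgue R d')
  end.

Lemma lebesgue_box (R : realType) (d : nat) (A : 'I_d -> set (measurableTypeR R)) :
  (forall i, measurable (A i)) ->
  lebesgue R d [set v | forall i, A i (tnth v i)] =
  (\prod_(i < d) lebesgue_measure (A i))%E.
Proof.
elim: d A => [|d IH] A mA /=.
  by rewrite big_ord0 diracE mem_set// => -[].
rewrite big_ord_recl -IH// -lebesgue_consE//; last first.
  rewrite (_ : mkset _ = \bigcap_(i in setT)
      ((fun v : velocity R d => tnth v i) @^-1` A (lift ord0 i))).
    apply: fin_bigcap_measurable => // i _; rewrite -[X in measurable X]setTI.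
    exact: (@measurable_tnth _ (measurableTypeR R) d i).
  by apply/seteqP; split=> v /= Av i; [move=> _|]; exact: Av.
congr (_ _); apply/seteqP; split=> v /=; rewrite [v]tuple_eta.
  move=> Av; rewrite theadE beheadE_tuple; split; first exact: (Av ord0).
  by move=> i; move: (Av (lift ord0 i)); rewrite tnthS.
rewrite theadE beheadE_tuple => -[A0 Av] i.
by case: (unliftP ord0 i) => [j|] ->; rewrite ?tnthS.
Qed.

Section sav_scheme.
Context (R : realType) (d : nat).
Local Notation V := (velocity R d).
Implicit Types (Omega : set V) (f : V -> R).

(* Functions on Omega are represented by functions on the whole of R^d, of
   which only the values on Omega matter. *)

Definition bounded_region Omega : Prop :=
  exists M : R, forall v, Omega v -> forall i, `|tnth v i : R| <= M.

Definition nonneg_on Omega f : Prop := forall v, Omega v -> 0 <= f v.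

Definition integrable_on Omega (g : V -> \bar R) : Prop :=
  (lebesgue R d).-integrable Omega g.

(* Meaningful when g is integrable on Omega, in which case the extended-real
   integral is finite. *)
Definition int_on Omega (g : V -> \bar R) : R :=
  fine (\int[lebesgue R d]_(v in Omega) g v).

(* lne 0 = -oo and 0 * -oo = 0 in \bar R. *)
Definition elog (x : R) : \bar R := lne x%:E.

Definition norm2 (v : V) : R := \sum_(i < d) (tnth v i : R) ^+ 2.

(* dom is the class of functions to which Q is applied. *)
Record collision_operator Omega (dom : set (V -> R))
    (Q : (V -> R) -> V -> R) : Prop := CollisionOperator {
  mass_integrable : forall f, dom f -> nonneg_on Omega f ->
    integrable_on Omega (fun v => (Q f v)%:E);
  mass_conservation : forall f, dom f -> nonneg_on Omega f ->
    int_on Omega (fun v => (Q f v)%:E) = 0;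
  momentum_integrable : forall f, dom f -> nonneg_on Omega f ->
    forall i, integrable_on Omega (fun v => (Q f v * (tnth v i : R))%:E);
  momentum_conservation : forall f, dom f -> nonneg_on Omega f ->
    forall i, int_on Omega (fun v => (Q f v * (tnth v i : R))%:E) = 0;
  energy_integrable : forall f, dom f -> nonneg_on Omega f ->
    integrable_on Omega (fun v => (Q f v * norm2 v)%:E);
  energy_conservation : forall f, dom f -> nonneg_on Omega f ->
    int_on Omega (fun v => (Q f v * norm2 v)%:E) = 0;
  dissipation_integrable : forall f, dom f -> nonneg_on Omega f ->
    integrable_on Omega (fun v => (Q f v)%:E * elog (f v))%E;
  H_theorem : forall f, dom f -> nonneg_on Omega f ->
    int_on Omega (fun v => (Q f v)%:E * elog (f v))%E <= 0
}.

Definition entropy Omega (C : R) f : R :=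
  int_on Omega (fun v => (f v)%:E * elog (f v))%E + C.

(* The values ftilde 0 and lambda 0 play no role. *)
Record SAV_1st_L Omega (Q : (V -> R) -> V -> R) (C dt : R)
    (f ftilde lambda : nat -> V -> R) (r : nat -> R) : Prop := SAV1stL {
  sav_init : r 0%N = Num.sqrt (entropy Omega C (f 0%N));
  sav_prediction_f : forall n v, Omega v ->
    (ftilde n.+1 v - f n v) / dt =
    r n.+1 / Num.sqrt (entropy Omega C (f n)) * Q (f n) v;
  sav_prediction_r : forall n,
    (r n.+1 - r n) / dt =
    1 / (2 * Num.sqrt (entropy Omega C (f n))) *
    int_on Omega
      (fun v => elog (f n v) * ((ftilde n.+1 v - f n v) / dt)%:E)%E;
  sav_correction : forall n v, Omega v ->
    (f n.+1 v - ftilde n.+1 v) / dt = lambda n.+1 v;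
  sav_multiplier_ge0 : forall n v, Omega v -> 0 <= lambda n.+1 v;
  sav_density_ge0 : forall n v, Omega v -> 0 <= f n.+1 v;
  sav_complementarity : forall n v, Omega v ->
    lambda n.+1 v * f n.+1 v = 0
}.

Definition modified_entropy (r : nat -> R) (n : nat) : R := r n ^+ 2.

End sav_scheme.

(* Main.v *)
Require Import Defs.
From mathcomp Require Import all_boot all_order all_algebra.
From mathcomp Require Import all_classical all_reals all_analysis.
From mathcomp Require Import ring.

Import Order.TTheory GRing.Theory Num.Theory.
Local Open Scope classical_set_scope.
Local Open Scope ring_scope.

(** Nonnegativity is imposed by the correction step, and holds at time 0 by
    assumption.

    For the entropy, both halves of the prediction step carry the factor
    1 / sqrt (H^n). Substituting the first into the integrand of the second and
    pulling the constant r^(n+1) / sqrt (H^n) out of the integral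
    ([sav_increment]) gives
      r^(n+1) - r^n = dt * r^(n+1) / (2 H^n) * D,
    where D is the integral of Q(f^n) log f^n. As the update of r is implicit,
    multiplying by 2 r^(n+1) makes the square (r^(n+1))^2 appear in front of D,
    and the left-hand side becomes the difference of the squares of r plus
    (r^(n+1) - r^n)^2: this is the dissipation identity. Its right-hand side is
    nonpositive for every dt because D <= 0 by the H-theorem. *)

(** [g] is extended-real valued because the logarithm is -oo where the density
    vanishes; integrability gives a finite integral, over which [fine] is
    multiplicative. *)
Lemma int_onZl (R : realType) (d : nat) (Omega : set (velocity R d))
    (c : R) (g : velocity R d -> \bar R) :
  measurable Omega -> integrable_on Omega g ->
  int_on Omega (fun v => c%:E * g v)%E = c * int_on Omega g.
Proof.
move=> mOmega gi; rewrite /int_on integralZl// fineM//.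
exact: integrable_fin_num.
Qed.

(** The increment of r is proportional to r^(n+1) itself, since the prediction
    of f carries r^(n+1) as a factor. *)
Lemma sav_increment (R : realType) (d : nat) (Omega : set (velocity R d))
    (Q : (velocity R d -> R) -> velocity R d -> R) (C dt : R)
    (f ftilde lambda : nat -> velocity R d -> R) (r : nat -> R) (n : nat) :
  measurable Omega -> dt != 0 -> 0 < entropy Omega C (f n) ->
  integrable_on Omega (fun v => (Q (f n) v)%:E * elog (f n v))%E ->
  SAV_1st_L Omega Q C dt f ftilde lambda r ->
  r n.+1 - r n =
    dt * r n.+1 / (2 * entropy Omega C (f n)) *
    int_on Omega (fun v => (Q (f n) v)%:E * elog (f n v))%E.
Proof.
move=> mOmega dt0 H_gt0 Qi sch.
have := sav_prediction_r sch n.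
set s := Num.sqrt _.
have s2 : s ^+ 2 = entropy Omega C (f n) by rewrite sqr_sqrtr// ltW.
have s0 : s != 0 by rewrite gt_eqF// sqrtr_gt0.
rewrite (_ : int_on Omega _ = r n.+1 / s *
    int_on Omega (fun v => (Q (f n) v)%:E * elog (f n v))%E); last first.
  rewrite -int_onZl//; congr fine; apply: eq_integral => v /[!inE] Ov.
  by rewrite (sav_prediction_f sch)// -/s EFinM muleC muleA.
move=> eq_r; rewrite -[LHS](divfK dt0) eq_r -s2.
by field; rewrite s0.
Qed.

(** The polarization identity
    a^2 - b^2 = - (a - b)^2 + 2 a (a - b), specialized to an increment a - b
    that is itself proportional to a. *)
Lemma implicit_square_increment (F : fieldType) (a b k : F) :
  a - b = k * a -> a ^+ 2 - b ^+ 2 = - (a - b) ^+ 2 + 2 * k * a ^+ 2.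
Proof.
move=> ab; transitivity (- (a - b) ^+ 2 + 2 * a * (a - b)); first by ring.
by rewrite {2}ab; ring.
Qed.

Theorem theorem4p1 (R : realType) (d : nat)
  (Omega : set (velocity R d))
  (Omega_measurable : measurable Omega)
  (Omega_bounded : bounded_region Omega)
  (dom : set (velocity R d -> R))
  (Q : (velocity R d -> R) -> velocity R d -> R)
  (Q_collision : collision_operator Omega dom Q)
  (C dt : R) (dt_gt0 : 0 < dt)
  (f ftilde lambda : nat -> velocity R d -> R) (r : nat -> R)
  (f0_ge0 : nonneg_on Omega (f 0%N))
  (f_dom : forall n, dom (f n))
  (entropy_integrable : forall n,
    integrable_on Omega (fun v => (f n v)%:E * elog (f n v))%E)
  (prediction_integrable : forall n,
    integrable_on Omega
      (fun v => elog (f n v) * ((ftilde n.+1 v - f n v) / dt)%:E)%E)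
  (entropy_gt0 : forall n, 0 < entropy Omega C (f n))
  (scheme : SAV_1st_L Omega Q C dt f ftilde lambda r) :
  forall n,
    nonneg_on Omega (f n) /\
    modified_entropy r n.+1 - modified_entropy r n =
      - (r n.+1 - r n) ^+ 2 +
      dt * r n.+1 ^+ 2 / entropy Omega C (f n) *
      int_on Omega (fun v => (Q (f n) v)%:E * elog (f n v))%E /\
    - (r n.+1 - r n) ^+ 2 +
      dt * r n.+1 ^+ 2 / entropy Omega C (f n) *
      int_on Omega (fun v => (Q (f n) v)%:E * elog (f n v))%E <= 0.
Proof.
have f_ge0 n : nonneg_on Omega (f n).
  by case: n => // n v; exact: sav_density_ge0 scheme n v.
move=> n; have H_gt0 := entropy_gt0 n.
have Qi := dissipation_integrable Q_collision (f_dom n) (f_ge0 n).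
have D_le0 := H_theorem Q_collision (f_dom n) (f_ge0 n).
have incr := sav_increment _ _ _ _ _ _ _ _ _ _ n Omega_measurable
  (lt0r_neq0 dt_gt0) H_gt0 Qi scheme.
split; [exact: f_ge0|split].
- rewrite /modified_entropy.
  set D := int_on _ _ in incr *; set H := entropy _ _ _ in H_gt0 incr *.
  have H0 : H != 0 by rewrite gt_eqF.
  rewrite (implicit_square_increment _ _ _ (dt / (2 * H) * D)).
    by congr (_ + _); field.
  by rewrite incr; field.
- rewrite -[leRHS]addr0 lerD ?oppr_le0 ?sqr_ge0// mulr_ge0_le0//.
  apply: divr_ge0; last exact: ltW.
  by apply: mulr_ge0; [exact: ltW|exact: sqr_ge0].
Qed.
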